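(* Let $m<\infty$, let $D$ be any finite data list in $\Gamma$, and let $z$ be a binary string of length $l=\ell(z)\le m$. If $\ell(z)<m$, the posterior satisfies the recursion (an identity of measures, written with generalized densities) $$p_z(\vec q_{z*}|D_z)=\frac{u}{p_z(D_z)}\prod_{y\in\mathbb B_1^{m-l}}\delta(q_{zy}-\tfrac12)\;+\;g_z(D_z)\,\mathrm{Beta}(q_{z0},q_{z1}|n_{z0}+\alpha,n_{z1}+\alpha)\,p_{z0}(\vec q_{z0*}|D_{z0})\,p_{z1}(\vec q_{z1*}|D_{z1}),$$ where $$g_z(D_z):=s\cdot\frac{p_{z0}(D_{z0})\,p_{z1}(D_{z1})}{p_z(D_z)\,w(n_{z0},n_{z1})}\;=\;1-\frac{u}{p_z(D_z)}.$$ The recursion terminates with $p_z(\vec q_{z*}|D_z)=1$ when $\ell(z)=m$.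
   Context: Tree partition. $\Gamma$ is a sample space of total volume $|\Gamma|=1$, $m$ is a finite tree height, and $\mathbb B_k^m=\bigcup_{i=k}^m\{0,1\}^i$ is the set of binary strings of length between $k$ and $m$ (empty if $k>m$). For each $z\in\mathbb B_0^m$ there is a set $\Gamma_z\subseteq\Gamma$, with $\Gamma_\epsilon=\Gamma$ for the empty string $\epsilon$, and for $\ell(z)<m$ the set $\Gamma_z$ is the disjoint union of $\Gamma_{z0}$ and $\Gamma_{z1}$ with $|\Gamma_{z0}|=|\Gamma_{z1}|=\frac12|\Gamma_z|$ (e.g. $\Gamma=[0,1)$ with dyadic intervals). For $x\in\Gamma$, $x_{1:i}$ is the unique string of length $i$ with $x\in\Gamma_{x_{1:i}}$. Write $l=\ell(z)$ for the length of $z$. Models. A model $q$ is a probability distribution on $\Gamma$ with density constant on each cell $\Gamma_{x'}$, $\ell(x')=m$. It is parametrized by branching probabilities $q_{z0}=P[\Gamma_{z0}|\Gamma_z,q]$ and $q_{z1}=P[\Gamma_{z1}|\Gamma_z,q]$, with $q_{z0}+q_{z1}=1$. Let $\vec q_{z*}:=(q_{zy}:y\in\mathbb B_1^{m-l})$ be the collection of all branching probabilities strictly below node $z$. Prior. Fix parameters $\alpha>0$ and $u,s\in[0,1]$ with $u+s=1$. The prior $p_z(\vec q_{z*})$ (a probability measure, written as a generalized density with Dirac deltas) is defined recursively: $p_z(\vec q_{z*})=1$ if $\ell(z)=m$ (empty collection; a density over the empty space is $1$), and for $\ell(z)<m$ $$p_z(\vec q_{z*})=u\prod_{y\in\mathbb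 B_1^{m-l}}\delta(q_{zy}-\tfrac12)+s\cdot\mathrm{Beta}(q_{z0},q_{z1}|\alpha,\alpha)\,p_{z0}(\vec q_{z0*})\,p_{z1}(\vec q_{z1*}),$$ where $\mathrm{Beta}(p,q|a,b)=\frac{\Gamma(a+b)}{\Gamma(a)\Gamma(b)}p^{a-1}q^{b-1}\delta(p+q-1)$ and $\Gamma(\cdot)$ with a real argument is the Gamma function. Likelihood, evidence, posterior. Data $D=(x^1,\dots,x^n)\in\Gamma^n$; $D_z$ is the sublist (with multiplicity) of data points lying in $\Gamma_z$, and $n_z:=|D_z|=n_{z0}+n_{z1}$. For $x\in\Gamma_z$, $p_z(x|q):=\prod_{i=l+1}^m 2q_{x_{1:i}}$ (empty product $=1$), and $p_z(D_z|\vec q_{z*}):=\prod_{x\in D_z}p_z(x|q)$. The evidence is $p_z(D_z):=\int p_z(D_z|\vec q_{z*})\,p_z(\vec q_{z*})\,d\vec q_{z*}$ and the posterior is $p_z(\vec q_{z*}|D_z):=p_z(D_z|\vec q_{z*})\,p_z(\vec q_{z*})/p_z(D_z)$. Weight. $w(n_{z0},n_{z1}):=2^{-n_z}\frac{\Gamma(n_z+2\alpha)}{\Gamma(n_{z0}+\alpha)\Gamma(n_{z1}+\alpha)}\cdot\frac{\Gamma(\alpha)^2}{\Gamma(2\alpha)}$. *)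

(* Defs.v *)
From HB Require Import structures.
From mathcomp Require Import all_boot all_order all_algebra.
From mathcomp Require Import all_classical all_reals all_analysis.

Import Order.TTheory GRing.Theory Num.Theory.
Import numFieldNormedType.Exports.

Local Open Scope classical_set_scope.
Local Open Scope ring_scope.

(* Priors, posteriors and Beta laws, written in the literature as generalized
   densities with Dirac deltas, are rendered as set functions.  As for the
   library's [integral], [product_measure1] (\x) and [pushforward], the
   definitions do not require a bundled measure; values on measurable sets are
   the ones that matter.  In strings, [false] stands for 0 and [true] for 1. *)

Section tree.
Context {d} {G : measurableType d} {R : realType}.

Record tree_partition (vol : probability G R) (m : nat)
    (cell : seq bool -> set G) : Prop := {
  cell_measurable : forall z, (size z <= m)%N -> measurable (cell z) ;
  cell_root : cell [::] = [set: G] ;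
  cell_split : forall z, (size z < m)%N ->
    cell z = cell (rcons z false) `|` cell (rcons z true) ;
  cell_disjoint : forall z, (size z < m)%N ->
    cell (rcons z false) `&` cell (rcons z true) = set0 ;
  cell_half : forall z (b : bool), (size z < m)%N ->
    vol (cell (rcons z b)) = ((2^-1)%:E * vol (cell z))%E }.

(* x_{1:i}; in a tree partition of height at least i, the set is a singleton. *)
Definition address (cell : seq bool -> set G) (x : G) (i : nat) : seq bool :=
  xget [::] [set y | size y = i /\ cell y x].

Definition subdata (cell : seq bool -> set G) (D : seq G) (z : seq bool) :=
  [seq x <- D | x \in cell z].

End tree.

Section branching.
Context {R : realType}.

(* Strings of length between 1 and k. *)
Definition bitstr (k : nat) : Type := {y : seq bool | (0 < size y <= k)%N}.

(* The space of the collections (q_{zy} : 1 <= |y| <= k), with the product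
   Borel sigma-algebra: at a node z of a tree of height m, k = m - |z| and the
   value at y is the branching probability q_{zy}. *)
Definition coordinate_sets (k : nat) : set (set (bitstr k -> R)) :=
  [set A | exists (y : bitstr k) (B : set R),
     measurable B /\ A = (fun q : bitstr k -> R => q y) @^-1` B].

Definition branching (k : nat) : Type :=
  g_sigma_algebraType (coordinate_sets k).
HB.instance Definition _ (k : nat) :=
  Measurable.copy (branching k) (g_sigma_algebraType (coordinate_sets k)).

(* q_{zy} for an untyped string y (0 if y is not an index of q). *)
Definition branch_prob {k : nat} (q : branching k) (y : seq bool) : R :=
  if insub y is Some i then q (i : bitstr k) else 0.

Definition uniform_branching (k : nat) : branching k := fun=> 2^-1.

(* Assembles (q_{z0}, q_{z1}), q_{z0*} and q_{z1*} into q_{z*}; the heights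
   k, k0, k1 are independent only so that no cast is needed: the intended use
   is k0 = k1 = k - 1. *)
Definition graft (k : nat) {k0 k1 : nat}
    (t : (R * R) * (branching k0 * branching k1)) : branching k :=
  fun y => match sval y with
           | [::] => 0
           | [:: b] => if b then t.1.2 else t.1.1
           | b :: y' => if b then branch_prob t.2.2 y' else branch_prob t.2.1 y'
           end.

Definition Gamma (a : R) : R :=
  \int[lebesgue_measure]_(t in `]0, +oo[) (t `^ (a - 1) * expR (- t)).

Definition Beta_density (a b p q : R) : R :=
  Gamma (a + b) / (Gamma a * Gamma b) * (p `^ (a - 1) * q `^ (b - 1)).

(* Beta(p, q | a, b) = Gamma(a+b) / (Gamma(a) Gamma(b)) p^(a-1) q^(b-1)
   delta(p + q - 1): the law on pairs (p, q) carried by the segment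
   p + q = 1, 0 <= p <= 1. *)
Definition Beta (a b : R) : set (R * R) -> \bar R :=
  fun A => (\int[lebesgue_measure]_(p in `[0%R, 1%R] `&`
    [set p : R | A (p, 1 - p)%R]) (Beta_density a b p (1 - p))%:E)%E.

(* The law with generalized density  Beta(q_{z0}, q_{z1} | a, b) * mu0(q_{z0*})
   * mu1(q_{z1*}). *)
Definition branch_law (k : nat) {k0 k1 : nat} (a b : R)
    (mu0 : set (branching k0) -> \bar R) (mu1 : set (branching k1) -> \bar R) :
    set (branching k) -> \bar R :=
  pushforward (Beta a b \x (mu0 \x mu1))%E (graft k).

(* prod_y delta(q_{zy} - 1/2), a point mass.  For k = 0 the collection is
   empty and this is the unit mass on a one-point space, i.e. the density 1. *)
Definition delta_half (k : nat) : set (branching k) -> \bar R :=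
  dirac (uniform_branching k).

(* The recursion for p_z involves z only through k = m - |z|. *)
Fixpoint prior_rec (alpha u s : R) (k : nat) : set (branching k) -> \bar R :=
  match k return set (branching k) -> \bar R with
  | 0 => delta_half 0
  | k'.+1 => fun A =>
     (u%:E * delta_half k'.+1 A +
      s%:E * branch_law k'.+1 alpha alpha (prior_rec alpha u s k')
               (prior_rec alpha u s k') A)%E
  end.

Definition weight (alpha : R) (n0 n1 : nat) : R :=
  2 ^- (n0 + n1) * (Gamma ((n0 + n1)%:R + 2 * alpha) /
    (Gamma (n0%:R + alpha) * Gamma (n1%:R + alpha))) *
  (Gamma alpha ^+ 2 / Gamma (2 * alpha)).

End branching.
Arguments branching R k : clear implicits.

Section bayes.
Context {d} {G : measurableType d} {R : realType}.
Variables (m : nat) (cell : seq bool -> set G) (alpha u s : R).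

Local Notation branching_at z := (branching R (m - size z)).

Definition prior (z : seq bool) : set (branching_at z) -> \bar R :=
  prior_rec alpha u s (m - size z).

(* p_z(x | q) for x in the cell of z: x_{1:i} = z y with y = drop |z| x_{1:i}. *)
Definition point_likelihood {z : seq bool} (x : G) (q : branching_at z) : R :=
  \prod_((size z).+1 <= i < m.+1)
    (2 * branch_prob q (drop (size z) (address cell x i))).

Definition likelihood {z : seq bool} (E : seq G) (q : branching_at z) : R :=
  \prod_(x <- E) point_likelihood x q.

Definition evidence (z : seq bool) (E : seq G) : R :=
  fine (\int[prior z]_(q in [set: branching_at z]) (likelihood E q)%:E)%E.

Definition posterior (z : seq bool) (E : seq G) :
    set (branching_at z) -> \bar R :=
  fun A => (\int[prior z]_(q in A) (likelihood E q / evidence z E)%:E)%E.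

End bayes.

(* Main.v *)
(* Under the prior at z, the likelihood of D_z is 1 on the point mass at 1/2; on
   the branching component it is (2 q_{z0})^{n0} (2 q_{z1})^{n1} times the
   likelihoods of D_{z0} and D_{z1} in the two subtrees.  Reweighting by it
   turns Beta(alpha, alpha) into 1/w times Beta(n0 + alpha, n1 + alpha), and the
   prior of each subtree into its evidence times its posterior.  Since
   B(a, b) = Gamma(a) Gamma(b) / Gamma(a + b), Beta laws have mass 1, so taking
   total masses gives p_z(D_z) = u + s p_{z0} p_{z1} / w.  This makes all
   evidences positive and gives the two formulas for g. *)
Require Import Defs.
From HB Require Import structures.
From mathcomp Require Import all_boot all_order all_algebra.
From mathcomp Require Import all_classical all_reals all_analysis.
From mathcomp Require Import measurable_realfun.
From mathcomp Require Import ring zify.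

Set Implicit Arguments.
Unset Strict Implicit.
Unset Printing Implicit Defensive.

Import Order.TTheory GRing.Theory Num.Theory.
Import numFieldNormedType.Exports.

Local Open Scope classical_set_scope.
Local Open Scope ring_scope.

(** * The Gamma function and the Beta integral *)

(** The laws are bare set functions, so the structure needed to integrate is recovered on the side:
    each prior equals some bundled probability, and identities between laws are proved on measurable
    sets only, which is all that [integral] and [\x] evaluate. An evidence is the [fine] part of an
    integral, so its finiteness must be proved together with its positivity; one induction on the
    remaining height carries both. To avoid circularity, the step at a node is stated for arbitrary
    positive constants in place of the evidences of the children, and instantiated afterwards. The
    heights m - |z0| and m - |z1| are not convertible to the predecessor of m - |z|, whence the
    equations [k = k0.+1] and [k1 = k0]. *)

Section lebesgue_affine.
Context {R : realType}.
Local Notation mu := (@lebesgue_measure R).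
Local Open Scope ereal_scope.

Lemma measurable_shift (c : R) : measurable_fun [set: R] (fun x : R => x - c)%R.
Proof. exact: measurable_funB. Qed.

(** Uniqueness of Lebesgue measure: its image under a translation still gives each half-open
    interval its length. *)
Lemma ge0_integral_shift (c : R) (f : R -> \bar R) :
  measurable_fun [set: R] f -> (forall x, 0 <= f x) ->
  \int[mu]_x f x = \int[mu]_x f (x - c)%R.
Proof.
move=> mf f0.
have E (A : set R) : measurable A ->
    mu A = pushforward mu (fun x : R => x - c : measurableTypeR R)%R A.
  move=> mA; apply: lebesgue_measure_unique => //=.
    exact: measurable_shift.
  move=> _ _ [[a b]] _ <-; rewrite /pushforward.
  have -> : (fun x : R => x - c : measurableTypeR R)%R @^-1` `]a, b] =
            `](a + c)%R, (b + c)%R]%classic.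
    by apply/seteqP; split => x /=; rewrite !in_itv/= ltrBrDr lerBlDr.
  rewrite !lebesgue_measure_itv/= !lte_fin ltrD2r; case: ifPn => // _.
  by rewrite -!EFinB; congr EFin; ring.
rewrite (eq_measure_integral
  (pushforward mu (fun x : R => x - c : measurableTypeR R)%R)).
- exact: measurable_shift.
- by move=> mshift; rewrite ge0_integral_pushforward.
- by move=> mshift A mA _; exact: E.
Qed.

(** The image of Lebesgue measure under multiplication by [c] gives ]a, b] the mass (b - a) / c; the
    scalar [c] restores the length. *)
Lemma ge0_integral_scale (c : R) (f : R -> \bar R) : (0 < c)%R ->
  measurable_fun [set: R] f -> (forall x, 0 <= f x) ->
  \int[mu]_x f x = c%:E * \int[mu]_x f (c * x)%R.
Proof.
move=> c0 mf f0.
have ms : measurable_fun [set: R] (fun x : R => c * x)%R.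
  exact: measurable_funM.
pose c' : {nonneg R} := NngNum (ltW c0).
have E (A : set R) : measurable A ->
    mu A =
    mscale c' (pushforward mu (fun x : R => c * x : measurableTypeR R)%R) A.
  move=> mA; apply: lebesgue_measure_unique => //=.
  move=> _ [[a b]] _ <-; rewrite /mscale/= /pushforward.
  have -> : (fun x : R => c * x : measurableTypeR R)%R @^-1` `]a, b] =
            `](a / c)%R, (b / c)%R]%classic.
    apply/seteqP; split => x /=;
      by rewrite !in_itv/= ltr_pdivrMr// ler_pdivlMr// mulrC.
  rewrite !lebesgue_measure_itv/= !lte_fin ltr_pM2r ?invr_gt0//.
  case: ifPn => // _.
    by rewrite -!EFinB -EFinM; congr EFin; field; rewrite gt_eqF.
  by rewrite mule0.
rewrite (eq_measure_integral
  (mscale c' (pushforward mu (fun x : R => c * x : measurableTypeR R)%R))).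
  by rewrite ge0_integral_mscale//= ge0_integral_pushforward.
by move=> A mA _; exact: E.
Qed.

End lebesgue_affine.

Lemma integral_EFin_restrict d (T : measurableType d) (R : realType)
    (mu : {measure set T -> \bar R}) (D : set T) (f : T -> R) :
  (\int[mu]_x ((f \_ D) x)%:E = \int[mu]_(x in D) (f x)%:E)%E.
Proof.
rewrite [RHS]integral_mkcond; apply: eq_integral => x _.
by rewrite !patchE; case: ifPn.
Qed.

(** * Euler's Gamma and Beta integrals *)

Section gamma_function.
Context {R : realType}.
Local Notation mu := (@lebesgue_measure R).
Implicit Types a b x : R.

(** Extended by 0 to the whole line, so that convolutions and Tonelli's theorem need no varying
    domains. *)
Definition gamma_density a : R -> R :=
  (fun x => x `^ (a - 1) * expR (- x)) \_ `]0, +oo[.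

Lemma measurable_gamma_density a : measurable_fun [set: R] (gamma_density a).
Proof.
apply/measurable_restrict => //; apply: measurable_funTS.
apply: measurable_funM; first exact: measurable_powR.
by apply: measurableT_comp => //; exact: measurable_expR.
Qed.

Lemma gamma_density_ge0 a x : 0 <= gamma_density a x.
Proof.
by apply: restrict_ge0 => {}x _; rewrite mulr_ge0 ?powR_ge0 ?expR_ge0.
Qed.

Lemma gamma_densityE a x : 0 < x ->
  gamma_density a x = x `^ (a - 1) * expR (- x).
Proof. by move=> x0; rewrite /gamma_density patchE mem_set//= in_itv/= x0. Qed.

Lemma gamma_density_le0 a x : x <= 0 -> gamma_density a x = 0.
Proof.
by move=> x0; rewrite /gamma_density patchE memNset//= in_itv/= andbT ltNge x0.
Qed.

(** For a < 1 the integrand is unbounded at 0, so the interval is exhausted by [1/(n+1), 1], where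
    x^a / a is an antiderivative. *)
Lemma integral_powR01 a : 0 < a ->
  (\int[mu]_(x in `]0%R, 1%R]) (x `^ (a - 1))%:E <= a^-1%:E)%E.
Proof.
move=> a0.
rewrite itv_open_bnd_bigcup.
have mp (D : set R) : measurable_fun D (fun x => (x `^ (a - 1))%:E).
  by apply/measurable_EFinP; apply: measurable_funTS; exact: measurable_powR.
set F := fun n : nat => [set` `[(0 + n.+1%:R^-1 : R), 1]].
have mF n : measurable (F n) by exact: measurable_itv.
have ndF : {homo F : n m / (n <= m)%N >-> (n <= m)%O}.
  move=> n m nm; apply/subsetPset => x.
  rewrite /F /= !in_itv/= => /andP[+ ->].
  rewrite andbT; apply: le_trans; rewrite lerD2l.
  by rewrite lef_pV2 ?posrE ?ltr0n// ler_nat ltnS.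
have /cvg_lim <- // : (\int[mu]_(x in F n) (x `^ (a - 1))%:E
    @[n --> \oo] --> \int[mu]_(x in \bigcup_n F n) (x `^ (a - 1))%:E)%E.
  apply: ge0_nondecreasing_set_cvg_integral => //.
  - by move=> n; exact: mp.
  - by move=> n x _; rewrite lee_fin powR_ge0.
apply: lime_le.
  apply: ereal_nondecreasing_is_cvgn.
  apply: ge0_nondecreasing_set_nondecreasing_integral => //.
  - by move=> n; exact: mp.
  - by move=> n x _; rewrite lee_fin powR_ge0.
apply: nearW => n; rewrite /F add0r.
set e : R := n.+1%:R^-1.
have e0 : 0 < e by rewrite invr_gt0.
have e1 : e <= 1 by rewrite invf_le1 ?ler1n.
(* For n = 0 the interval shrinks to the point 1, a case apart because [continuous_FTC2] is for a
   nondegenerate interval. *)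
have [e1'|] := ltP e 1; last first.
  move=> e1'; have -> : e = 1 by apply/eqP; rewrite eq_le e1 e1'.
  by rewrite set_itv1 integral_set1 lee_fin invr_ge0 ltW.
have dp x : 0 < x -> is_derive x 1 (fun y => a^-1 * y `^ a) (x `^ (a - 1)).
  move=> x0; have := @is_derive1_powR R a x x0 => H.
  apply: is_derive_eq.
  by rewrite /GRing.scale/= mulrA mulVf ?gt_eqF// mul1r.
rewrite (@continuous_FTC2 _ _ (fun y => a^-1 * y `^ a))//.
- rewrite -EFinB lee_fin powR1 mulr1 lerBlDr lerDl.
  rewrite mulr_ge0 ?invr_ge0 ?powR_ge0//.
  exact: ltW.
- apply: continuous_in_subspaceT => x; rewrite inE/= in_itv/= => /andP[ex _].
  have := @is_derive1_powR R (a - 1) x (lt_le_trans e0 ex).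
  by move=> H; apply/differentiable_continuous/derivable1_diffP.
- have cp x : 0 < x -> {for x, continuous (fun y => a^-1 * y `^ a)}.
    move=> x0; have H := dp _ x0.
    by apply/differentiable_continuous/derivable1_diffP.
  split.
  + move=> x; rewrite in_itv/= => /andP[ex _].
    by have H := dp _ (lt_trans e0 ex).
  + by apply: cvg_at_right_filter; exact: cp.
  + by apply: cvg_at_left_filter; exact: cp.
- move=> x; rewrite in_itv/= => /andP[ex _].
  have H := dp _ (lt_trans e0 ex).
  by rewrite derive1E derive_val.
Qed.

(** Domination by x^(a-1) on ]0, 1] and by a multiple of the exponential density of rate 1/2 beyond
    1. *)
Lemma integral_gamma_density_lty a : 0 < a ->
  (\int[mu]_x (gamma_density a x)%:E < +oo)%E.
Proof.
move=> a0.
have [n an] : exists n : nat, a - 1 <= n.+1%:R.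
  exists (Num.trunc `|a|); rewrite (@le_trans _ _ `|a|)//.
    by rewrite (le_trans _ (ler_norm _))// lerBlDr lerDl.
  by apply: ltW; rewrite truncnS_gt.
(* The Taylor bound (x/2)^(n+1) / (n+1)! <= exp(x/2) gives the first two factors; the last one
   cancels the rate 1/2 in the exponential density. *)
pose C : R := 2 ^+ n.+1 * (n.+1)`!%:R * 2.
have C0 : 0 <= C by rewrite !mulr_ge0.
pose f1 := (fun x => x `^ (a - 1)) \_ `]0, 1].
have f10 x : 0 <= f1 x by apply: restrict_ge0 => y _; exact: powR_ge0.
have mf1 : measurable_fun [set: R] f1.
  apply/measurable_restrict => //; apply: measurable_funTS.
  exact: measurable_powR.
pose f2 := exponential_pdf (2^-1 : R).
have f20 x : 0 <= f2 x by apply: exponential_pdf_ge0.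
have mf2 : measurable_fun [set: R] f2 by apply: measurable_exponential_pdf.
apply: (@le_lt_trans _ _ (\int[mu]_x ((f1 x)%:E + C%:E * (f2 x)%:E))%E).
  apply: ge0_le_integral => //.
  - by move=> x _; rewrite lee_fin gamma_density_ge0.
  - by apply/measurable_EFinP; exact: measurable_gamma_density.
  - apply: emeasurable_funD; first exact/measurable_EFinP.
    by apply: measurable_funeM; exact/measurable_EFinP.
  move=> x _; rewrite -EFinM -EFinD lee_fin.
  have [x0|x0] := leP x 0.
    by rewrite gamma_density_le0// addr_ge0// mulr_ge0.
  rewrite gamma_densityE//.
  have [x1|x1] := leP x 1.
    rewrite ler_wpDr// ?mulr_ge0// /f1 patchE mem_set/= ?in_itv/= ?x0//.
    by rewrite ler_piMr ?powR_ge0// expR_le1 oppr_le0 ltW.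
  rewrite ler_wpDl// /f2 exponential_pdfE ?(ltW x0)//.
  have -> : - x = - (x / 2) + - 2^-1 * x by field.
  rewrite expRD !mulrA ler_pM2r ?expR_gt0// /C -!mulrA mulfV// mulr1.
  rewrite expRN ler_pdivrMr ?expR_gt0//.
  apply: (@le_trans _ _ (x ^+ n.+1)).
    by rewrite -powR_mulrn ?(ltW x0)// ler_powR// ltW.
  have := @expR_ge1Dxn R (x / 2) n (divr_ge0 (ltW x0) (ler0n _ _)).
  move=> /(le_trans (ler_wpDl ler01 (lexx _))).
  rewrite ler_pdivrMr ?ltr0n ?fact_gt0//.
  move=> /(ler_wpM2l (exprn_ge0 n.+1 (ler0n R 2))).
  by rewrite -exprMn mulrCA mulfV// mulr1 [expR _ * _]mulrC mulrA.
rewrite ge0_integralD//; first last.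
- by apply: measurable_funeM; exact/measurable_EFinP.
- by move=> x _; rewrite -EFinM lee_fin mulr_ge0.
- exact/measurable_EFinP.
- by move=> x _; rewrite lee_fin.
rewrite lte_add_pinfty//.
  rewrite (le_lt_trans _ (ltry a^-1))// (le_trans _ (integral_powR01 a0))//.
  by rewrite /f1 integral_EFin_restrict.
rewrite ge0_integralZl//; last 2 first.
  exact/measurable_EFinP.
  by move=> x _; rewrite lee_fin.
by rewrite integral_exponential_pdf// mule1 ltry.
Qed.

Lemma EFin_Gamma a : 0 < a ->
  ((Gamma a)%:E = \int[mu]_x (gamma_density a x)%:E)%E.
Proof.
move=> a0; rewrite /Gamma /Rintegral fineK.
  by rewrite /gamma_density integral_EFin_restrict.
rewrite -integral_EFin_restrict ge0_fin_numE.
  exact: integral_gamma_density_lty.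
by apply: integral_ge0 => x _; rewrite lee_fin gamma_density_ge0.
Qed.

(** A zero integral would make the density vanish almost everywhere, whereas it is positive on ]0,
    1[, a set of measure 1. *)
Lemma Gamma_gt0 a : 0 < a -> 0 < Gamma a.
Proof.
move=> a0; rewrite -lte_fin EFin_Gamma// lt_neqAle.
apply/andP; split; last first.
  by apply: integral_ge0 => x _; rewrite lee_fin gamma_density_ge0.
apply/eqP => /esym I0.
have /(ae_eq_integral_abs _ measurableT) :
    (\int[mu]_x `|(gamma_density a x)%:E| = 0)%E.
  rewrite -[RHS]I0; apply: eq_integral => x _.
  by rewrite gee0_abs// lee_fin gamma_density_ge0.
have mg : measurable_fun [set: R] (EFin \o gamma_density a).
  by apply/measurable_EFinP; exact: measurable_gamma_density.
move=> /(_ mg)[N [mN N0 subN]].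
have : (mu `]0%R, 1%R[ <= mu N)%E.
  apply: le_measure; rewrite ?inE//.
  move=> x /=; rewrite in_itv/= => /andP[x0 _]; apply: subN => /=.
  move=> /(_ I) []; apply/eqP; rewrite gt_eqF// gamma_densityE//.
  by rewrite mulr_gt0 ?powR_gt0 ?expR_gt0.
by rewrite N0 lebesgue_measure_itv/= lte_fin ltr01 oppr0 adde0 lee_fin ler10.
Qed.

(** The interval is open so that the pointwise identity of [gamma_convolution] also holds at 0 and
    1, where one of the two [gamma_density] factors vanishes even if an exponent is 0. *)
Definition beta_density a b : R -> R :=
  (fun x => x `^ (a - 1) * (1 - x) `^ (b - 1)) \_ `]0, 1[.

Lemma measurable_beta_density a b : measurable_fun [set: R] (beta_density a b).
Proof.
apply/measurable_restrict => //; apply: measurable_funTS.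
apply: measurable_funM; first exact: measurable_powR.
by apply: measurableT_comp (measurable_powR _) _; exact: measurable_funB.
Qed.

Lemma beta_density_ge0 a b x : 0 <= beta_density a b x.
Proof.
by apply: restrict_ge0 => {}x _; rewrite mulr_ge0 ?powR_ge0.
Qed.

(* The substitution x = t p turns the convolution integral into the Beta
   integral. *)
Lemma gamma_convolution a b t :
  (\int[mu]_x (gamma_density a x * gamma_density b (t - x))%:E =
   (gamma_density (a + b) t)%:E * \int[mu]_x (beta_density a b x)%:E)%E.
Proof.
have mc : measurable_fun [set: R]
    (fun x => (gamma_density a x * gamma_density b (t - x))%:E).
  apply/measurable_EFinP; apply: measurable_funM.
    exact: measurable_gamma_density.
  apply: measurableT_comp; first exact: measurable_gamma_density.
  exact: measurable_funB.
have [t0|t0] := leP t 0.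
  rewrite (gamma_density_le0 _ t0) mul0e; apply: integral0_eq => x _.
  have [x0|x0] := leP x 0; first by rewrite gamma_density_le0// mul0r.
  rewrite [gamma_density b _]gamma_density_le0 ?mulr0//.
  by rewrite subr_le0 (le_trans t0)// ltW.
rewrite (ge0_integral_scale t0)//; last first.
  by move=> x; rewrite lee_fin mulr_ge0 ?gamma_density_ge0.
rewrite -!ge0_integralZl//; last first.
- by rewrite lee_fin ltW.
- by move=> x _; rewrite lee_fin mulr_ge0 ?gamma_density_ge0.
- by apply: measurableT_comp mc _; exact: measurable_funM.
- by rewrite lee_fin gamma_density_ge0.
- by move=> x _; rewrite lee_fin beta_density_ge0.
- by apply/measurable_EFinP; exact: measurable_beta_density.
apply: eq_integral => x _; rewrite -!EFinM; congr EFin.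
rewrite /beta_density patchE; have [/andP[x0 x1]|] := boolP (0 < x < 1).
  rewrite mem_set/= ?in_itv/= ?x0//.
  rewrite !gamma_densityE ?mulr_gt0//; last first.
    by rewrite subr_gt0 gtr_pMr.
  have -> : t - t * x = t * (1 - x) by ring.
  rewrite !powRM ?(ltW t0) ?(ltW x0) ?subr_ge0 ?(ltW x1)//.
  have -> : t `^ (a + b - 1) = t * (t `^ (a - 1) * t `^ (b - 1)).
    have -> : a + b - 1 = 1 + ((a - 1) + (b - 1)) by ring.
    by rewrite !powRD ?(gt_eqF t0) ?implybT// powRr1// ltW.
  have -> : expR (- t) = expR (- (t * x)) * expR (- (t * (1 - x))).
    by rewrite -expRD; congr expR; ring.
  by ring.
move=> x01; rewrite memNset/= ?in_itv/=; last exact/negP.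
move: x01; rewrite mulr0.
have [x0 _|x0] := leP x 0.
  by rewrite gamma_density_le0 ?mul0r ?mulr0// pmulr_rle0.
rewrite -leNgt => x1.
rewrite [gamma_density b _]gamma_density_le0 ?mulr0//.
by rewrite subr_le0 ler_peMr// ltW.
Qed.

(** The product of the two Gamma integrals is a double integral; shifting the inner variable and
    exchanging the order turns it into the integral of a convolution. *)
Lemma Gamma_beta a b : 0 < a -> 0 < b ->
  (\int[mu]_x (beta_density a b x)%:E =
   (Gamma a * Gamma b / Gamma (a + b))%:E)%E.
Proof.
move=> a0 b0; have ab0 : 0 < a + b by rewrite addr_gt0.
set B := (\int[mu]_x (beta_density a b x)%:E)%E.
have mga c : measurable_fun [set: R] (fun x => (gamma_density c x)%:E).
  by apply/measurable_EFinP; exact: measurable_gamma_density.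
have ga0 := gamma_density_ge0.
have B0 : (0 <= B)%E.
  by apply: integral_ge0 => x _; rewrite lee_fin beta_density_ge0.
(* [B] is so far only in [0, +oo]; cancelling the finite nonzero factor Gamma(a + b) spares a
   separate proof of finiteness. *)
suff E : ((Gamma a)%:E * (Gamma b)%:E = (Gamma (a + b))%:E * B)%E.
  have G0 : Gamma (a + b) != 0 by rewrite gt_eqF// Gamma_gt0.
  by rewrite mulrC EFinM EFinM E muleA -EFinM mulVf// mul1e.
rewrite !EFin_Gamma// -ge0_integralZr//; first last.
- by apply: integral_ge0 => x _; rewrite lee_fin.
- by move=> x _; rewrite lee_fin.
- exact: mga.
have mg (x : R) :
    measurable_fun [set: R] (fun t => (gamma_density b (t - x))%:E).
  by apply: measurableT_comp (mga b) _; exact: measurable_funB.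
transitivity (\int[mu]_x \int[mu]_t
    (gamma_density a x * gamma_density b (t - x))%:E)%E.
  apply: eq_integral => x _.
  rewrite (ge0_integral_shift x)//; last by move=> y; rewrite lee_fin.
  rewrite -ge0_integralZl//; first last.
  - by rewrite lee_fin.
  - by move=> t _; rewrite lee_fin.
  - exact: mg.
pose F (z : R * R) := (gamma_density a z.1 * gamma_density b (z.2 - z.1))%:E.
have mF : measurable_fun [set: R * R] F.
  apply/measurable_EFinP; apply: measurable_funM.
    by apply: measurableT_comp measurable_fst; exact: measurable_gamma_density.
  apply: measurableT_comp; first exact: measurable_gamma_density.
  by apply: measurable_funB; [exact: measurable_snd|exact: measurable_fst].
have F0 z : (0 <= F z)%E by rewrite lee_fin mulr_ge0.
transitivity (\int[mu]_t \int[mu]_x F (x, t))%E.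
  exact: (@fubini_tonelli _ _ _ _ _ mu mu F mF F0).
rewrite -ge0_integralZr//; first last.
- by move=> x _; rewrite lee_fin.
- exact: mga.
by apply: eq_integral => t _; rewrite /F /= gamma_convolution.
Qed.

End gamma_function.

(** * Measures with densities *)

Section integral_set_function.
Context d (T : measurableType d) (R : realType).
Import HBNNSimple.

(* Unlike [eq_measure_integral], this needs no bundled measures: [integral]
   only evaluates its set function on measurable sets. *)
Lemma eq_set_function_integral (m1 m2 : set T -> \bar R) (D : set T)
    (f : T -> \bar R) :
  (forall A, measurable A -> m1 A = m2 A) ->
  (\int[m1]_(x in D) f x = \int[m2]_(x in D) f x)%E.
Proof.
move=> m12; rewrite /integral.
have E (h : {nnsfun T >-> R}) : sintegral m1 h = sintegral m2 h.
  apply: eq_fsbigr => r _; congr (_ * _)%E; apply: m12.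
  exact: measurable_sfunP.
by congr (ereal_sup _ - ereal_sup _)%E; apply/seteqP; split => _ [h hf <-];
  exists h.
Qed.

End integral_set_function.

Section density.
Context d (T : measurableType d) (R : realType).
Local Open Scope ereal_scope.

(** [mu] is a bare set function so that [prior_rec] can take its place. *)
Definition density (mu : set T -> \bar R) (h : T -> R) : set T -> \bar R :=
  fun A => \int[mu]_(x in A) (h x)%:E.

Section density_measure.
Variables (mu : {measure set T -> \bar R}) (h : T -> R).
Hypotheses (mh : measurable_fun [set: T] h) (h0 : forall x, (0 <= h x)%R).

Let density0 : density mu h set0 = 0.
Proof. exact: integral_set0. Qed.

Let density_ge0 A : 0 <= density mu h A.
Proof. by apply: integral_ge0 => x _; rewrite lee_fin. Qed.

Let density_sigma_additive : semi_sigma_additive (density mu h).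
Proof.
move=> /= F mF tF mUF; rewrite /density; apply: cvg_toP.
  apply: ereal_nondecreasing_is_cvgn => m n mn.
  apply: lee_sum_nneg_natr => // k _ _; apply: integral_ge0 => /= x Fkx.
  by rewrite lee_fin.
rewrite ge0_integral_bigcup//=.
- exact/measurable_funTS/measurable_EFinP.
- by move=> x _; rewrite lee_fin.
Qed.

HB.instance Definition _ := isMeasure.Build _ _ _ (density mu h)
  density0 density_ge0 density_sigma_additive.

Definition density_measure : {measure set T -> \bar R} := density mu h.

Import HBNNSimple.

(** For an indicator this is the definition of [density]; linearity extends it to simple functions,
    and monotone convergence along [nnsfun_approx] to [f]. *)
Lemma ge0_integral_density (f : T -> \bar R) :
  measurable_fun [set: T] f -> (forall x, 0 <= f x) ->
  \int[density mu h]_x f x = \int[mu]_x (f x * (h x)%:E).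
Proof.
move=> mf f0; rewrite -/density_measure.
have mhE : measurable_fun [set: T] (EFin \o h) by exact/measurable_EFinP.
pose g := nnsfun_approx measurableT mf.
have gf x : EFin \o g ^~ x @ \oo --> f x by exact: cvg_nnsfun_approx.
have -> : \int[density_measure]_x f x =
    limn (fun n => \int[density_measure]_x (g n x)%:E).
  rewrite -monotone_convergence//.
  - by apply: eq_integral => x _; apply/esym/cvg_lim => //; exact: gf.
  - by move=> n; exact/measurable_EFinP.
  - by move=> n x _; rewrite lee_fin.
  - by move=> x _ a b ab; rewrite lee_fin; exact/lefP/nd_nnsfun_approx.
have -> : \int[mu]_x (f x * (h x)%:E) =
    limn (fun n => \int[mu]_x ((g n x)%:E * (h x)%:E)).
  rewrite -monotone_convergence//.
  - apply: eq_integral => x _; apply/esym/cvg_lim => //.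
    by apply: cvgeZr => //; exact: gf.
  - by move=> n; apply: emeasurable_funM => //; exact/measurable_EFinP.
  - by move=> n x _; rewrite mule_ge0// lee_fin.
  - move=> x _ a b ab; rewrite lee_wpmul2r ?lee_fin//.
    exact/lefP/nd_nnsfun_approx.
congr (limn _); apply/funext => n.
transitivity (\int[density_measure]_x
   (\sum_(y \in range (g n)) (y * \1_(g n @^-1` [set y]) x)%:E)).
  by apply: eq_integral => t _; rewrite fimfunE -fsumEFin.
rewrite ge0_integral_fsum//; last 2 first.
- by move=> r; apply/measurable_EFinP; exact: measurable_funM.
- by move=> r x _; exact: nnfun_muleindic_ge0.
transitivity (\int[mu]_x (\sum_(y \in range (g n))
    (y * \1_(g n @^-1` [set y]) x)%:E * (h x)%:E)); last first.
  apply: eq_integral => x _.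
  rewrite -ge0_mule_fsuml => [|y]; last exact: nnfun_muleindic_ge0.
  by rewrite fsumEFin // -(fimfunE _ x).
rewrite ge0_integral_fsum//; last 2 first.
- move=> r; apply: emeasurable_funM => //.
  by apply/measurable_EFinP; exact: measurable_funM.
- by move=> r x _; rewrite mule_ge0 ?lee_fin// -lee_fin nnfun_muleindic_ge0.
apply: eq_fsbigr => r rhn.
under eq_integral do rewrite EFinM.
rewrite integralZl_indic_nnsfun//.
under [RHS]eq_integral do rewrite EFinM -muleA.
rewrite ge0_integralZl//.
- congr (_ * _); rewrite integral_indic//= setIT /density.
  rewrite [LHS]integral_mkcond; apply: eq_integral => x _.
  by rewrite patchE indicE; case: ifPn => _; rewrite ?mul1e ?mul0e.
- apply: emeasurable_funM => //; exact/measurable_EFinP.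
- by move=> t _; rewrite mule_ge0 ?lee_fin.
- by move: rhn; rewrite inE => -[t _ <-]; rewrite lee_fin.
Qed.

End density_measure.
End density.

(** * Products of laws with densities *)

Section product_density.
Context d1 d2 (T1 : measurableType d1) (T2 : measurableType d2) (R : realType).
Variables (mu1 : {sigma_finite_measure set T1 -> \bar R})
          (mu2 : {sigma_finite_measure set T2 -> \bar R}).
Variables (f1 : T1 -> R) (f2 : T2 -> R).
Hypotheses (mf1 : measurable_fun [set: T1] f1) (f10 : forall x, 0 <= f1 x).
Hypotheses (mf2 : measurable_fun [set: T2] f2) (f20 : forall x, 0 <= f2 x).
Local Open Scope ereal_scope.

Let mf12 : measurable_fun [set: T1 * T2] (fun z => (f1 z.1 * f2 z.2)%R).
Proof.
apply: measurable_funM.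
  exact: measurableT_comp mf1 measurable_fst.
exact: measurableT_comp mf2 measurable_snd.
Qed.

(** [\x] integrates the measures of sections, so the factors matter only through their values on
    measurable sets, and Tonelli is applied to the bundled [mu1] and [mu2] alone. *)
Lemma product_density (m1 : set T1 -> \bar R) (m2 : set T2 -> \bar R)
    (B : set (T1 * T2)) :
  (forall A, measurable A -> m1 A = density mu1 f1 A) ->
  (forall A, measurable A -> m2 A = density mu2 f2 A) ->
  measurable B ->
  (m1 \x m2) B = density (mu1 \x mu2) (fun z => f1 z.1 * f2 z.2)%R B.
Proof.
move=> m1E m2E mB; rewrite [LHS]/product_measure1.
rewrite (eq_set_function_integral _ _ m1E).
(* Restricting to [B] before fixing the first coordinate turns the density measure of a section into
   an inner integral over the whole space. *)
pose F (z : T1 * T2) := ((fun z => (f2 z.2)%:E) \_ B) z.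
have mF : measurable_fun [set: T1 * T2] F.
  apply/measurable_restrict => //; apply: measurable_funTS.
  by apply/measurable_EFinP; exact: measurableT_comp mf2 measurable_snd.
have F0 z : 0 <= F z by apply: erestrict_ge0 => z' _; rewrite lee_fin.
have E x : (m2 \o xsection B) x = \int[mu2]_y F (x, y).
  rewrite /= m2E; last exact: measurable_xsection.
  rewrite /density integral_mkcond; apply: eq_integral => y _.
  by rewrite /F !patchE /= mem_xsection.
rewrite (eq_integral (fun x => \int[mu2]_y F (x, y))); last by move=> x _.
rewrite (ge0_integral_density _ mf1 f10); last 2 first.
- exact: measurable_fun_fubini_tonelli_F.
- by move=> x; exact: integral_ge0.
rewrite /density [RHS]integral_mkcond.
pose G (z : T1 * T2) := ((fun z => (f1 z.1 * f2 z.2)%:E) \_ B) z.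
have mG : measurable_fun [set: T1 * T2] G.
  apply/measurable_restrict => //; apply: measurable_funTS.
  exact/measurable_EFinP.
have G0 z : 0 <= G z.
  by apply: erestrict_ge0 => z' _; rewrite lee_fin mulr_ge0.
transitivity (\int[mu1]_x \int[mu2]_y G (x, y)); last first.
  by apply/esym; exact: fubini_tonelli1.
apply: eq_integral => x _.
rewrite /fubini_F -ge0_integralZr//.
- apply: eq_integral => y _; rewrite /F /G !patchE /=; case: ifPn => _.
    by rewrite EFinM muleC.
  by rewrite mul0e.
- by apply: measurableT_comp mF _; exact: measurable_pair1.
- by rewrite lee_fin.
Qed.

Lemma integral_product_density :
  \int[mu1 \x mu2]_z (f1 z.1 * f2 z.2)%:E =
  \int[mu1]_x (f1 x)%:E * \int[mu2]_y (f2 y)%:E.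
Proof.
rewrite fubini_tonelli1//; last 2 first.
- exact/measurable_EFinP.
- by move=> z; rewrite lee_fin mulr_ge0.
rewrite -ge0_integralZr//; first last.
- by apply: integral_ge0 => y _; rewrite lee_fin.
- by move=> x _; rewrite lee_fin.
- exact/measurable_EFinP.
apply: eq_integral => x _; rewrite /fubini_F -ge0_integralZl//.
- exact/measurable_EFinP.
- by move=> y _; rewrite lee_fin.
- by rewrite lee_fin.
Qed.

End product_density.

(** * The Beta law and the prior *)

Section Beta_law.
Context {R : realType}.
Local Notation mu := (@lebesgue_measure R).
Implicit Types (a b : R) (p : R) (A : set (R * R)).

Local Opaque Gamma.

Definition segment_density a b : R -> R :=
  (fun p => Beta_density a b p (1 - p)) \_ `[0, 1].

Lemma measurable_segment_density a b :
  measurable_fun [set: R] (segment_density a b).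
Proof.
apply/measurable_restrict => //; apply: measurable_funTS.
apply: measurable_funM => //; apply: measurable_funM.
  exact: measurable_powR.
by apply: measurableT_comp (measurable_powR _) _; exact: measurable_funB.
Qed.

Definition segment p : R * R := (p, 1 - p).

Lemma measurable_segment : measurable_fun [set: R] segment.
Proof. by apply: measurable_fun_pair => //; exact: measurable_funB. Qed.

(** Seen as the image of a density on the line under p |-> (p, 1 - p), [Beta] inherits
    sigma-additivity and a change of variables. *)
Lemma BetaE a b A :
  Beta a b A = pushforward (density mu (segment_density a b)) segment A.
Proof.
rewrite /Beta /pushforward /density setIC integral_mkcondr.
by apply: eq_integral => p _; rewrite /segment_density !patchE; case: ifPn.
Qed.

Section Beta_probability.
Variables a b : R.
Hypotheses (a0 : 0 < a) (b0 : 0 < b).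

Lemma segment_density_ge0 p : 0 <= segment_density a b p.
Proof.
apply: restrict_ge0 => {}p _.
rewrite !mulr_ge0 ?powR_ge0 ?invr_ge0 ?mulr_ge0 //;
  by rewrite ltW ?Gamma_gt0 ?addr_gt0.
Qed.

Let Beta0 : Beta a b set0 = 0%E.
Proof. by rewrite BetaE /pushforward preimage_set0 /density integral_set0. Qed.

Let Beta_ge0 A : (0 <= Beta a b A)%E.
Proof.
rewrite BetaE; apply: integral_ge0 => p _.
by rewrite lee_fin segment_density_ge0.
Qed.

Let Beta_sigma_additive : semi_sigma_additive (Beta a b).
Proof.
rewrite (_ : Beta a b =
    pushforward (density_measure mu (@measurable_segment_density a b)
      segment_density_ge0) segment :> (set (R * R) -> \bar R));
  last by apply/funext => A; exact: BetaE.
apply: measure_semi_sigma_additive; exact: measurable_segment.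
Qed.


HB.instance Definition _ := isMeasure.Build _ _ _ (Beta a b)
  Beta0 Beta_ge0 Beta_sigma_additive.

Lemma ge0_integral_Beta (f : R * R -> \bar R) :
  measurable_fun [set: R * R] f -> (forall q, (0 <= f q)%E) ->
  (\int[Beta a b]_q f q =
   \int[mu]_p (f (segment p) * (segment_density a b p)%:E))%E.
Proof.
move=> mf f0.
have mD := @measurable_segment_density a b.
have mfs : measurable_fun [set: R] (f \o segment).
  exact: measurableT_comp mf measurable_segment.
rewrite -(ge0_integral_density mu mD segment_density_ge0 mfs)//; last first.
  by move=> p; exact: f0.
rewrite (_ : Beta a b = pushforward
    (density_measure mu mD segment_density_ge0) segment
    :> (set (R * R) -> \bar R)); last by apply/funext => A; exact: BetaE.
rewrite ge0_integral_pushforward//; exact: measurable_segment.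
Qed.

Let Beta_setT : Beta a b setT = 1%E.
Proof.
rewrite BetaE /pushforward preimage_setT /density.
rewrite integral_EFin_restrict.
have mb : measurable_fun [set: R] (EFin \o beta_density a b).
  by apply/measurable_EFinP; exact: measurable_beta_density.
(* The endpoints of the segment are null, so the open interval of [beta_density] suffices. *)
transitivity (\int[mu]_(p in `]0%R, 1%R[)
    ((Gamma (a + b) / (Gamma a * Gamma b))%:E * (beta_density a b p)%:E))%E.
  rewrite integral_itv_bndoo; last first.
    apply/measurable_EFinP; apply: measurable_funTS.
    apply: measurable_funM => //; apply: measurable_funM.
      exact: measurable_powR.
    by apply: measurableT_comp (measurable_powR _) _; exact: measurable_funB.
  apply: eq_integral => p; rewrite inE => p01.
  by rewrite /Beta_density /beta_density patchE mem_set// EFinM.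
have K0 : 0 <= Gamma (a + b) / (Gamma a * Gamma b).
  by rewrite divr_ge0 ?mulr_ge0 ?ltW ?Gamma_gt0 ?addr_gt0.
rewrite ge0_integralZl//; last 2 first.
- exact: measurable_funTS.
- by move=> p _; rewrite lee_fin beta_density_ge0.
have -> : (\int[mu]_(p in `]0%R, 1%R[) (beta_density a b p)%:E =
    \int[mu]_p (beta_density a b p)%:E)%E.
  rewrite integral_mkcond; apply: eq_integral => p _.
  by rewrite /beta_density !patchE; case: ifPn => // ->.
rewrite Gamma_beta// -EFinM; congr EFin.
rewrite -[X in X * _]invf_div mulVf// gt_eqF// divr_gt0 ?mulr_gt0//;
  by rewrite Gamma_gt0// addr_gt0.
Qed.

HB.instance Definition _ :=
  Measure_isProbability.Build _ _ _ (Beta a b) Beta_setT.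

Definition Beta_probability : probability (R * R)%type R := Beta a b.

End Beta_probability.

(* The normalizing factor of q0^n0 q1^n1 under Beta(a, b). *)
Definition Beta_update a b (n0 n1 : nat) : R :=
  Gamma ((n0%:R + a) + (n1%:R + b)) / (Gamma (n0%:R + a) * Gamma (n1%:R + b)) *
  (Gamma a * Gamma b / Gamma (a + b)).

(* Also true at [p = 0], where [0 `^ r] is [1] if [r = 0] and [0] otherwise. *)
Lemma powR_natD (n : nat) a p : 0 < a -> 0 <= p ->
  p `^ (n%:R + a - 1) = p ^+ n * p `^ (a - 1).
Proof.
move=> a0; rewrite le_eqVlt => /predU1P[<-|p0].
  case: n => [|n]; first by rewrite add0r expr0 mul1r.
  by rewrite expr0n mul0r powR0// gt_eqF// -natr1 addrAC addrK ltr_wpDl.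
by rewrite -addrA (powRD (r := n%:R)) ?(gt_eqF p0) ?implybT// powR_mulrn// ltW.
Qed.

(** The absolute values change nothing on the segment, but keep the reweighting factor nonnegative
    on all of R * R, as a density must be. *)
Lemma segment_density_update a b n0 n1 p : 0 < a -> 0 < b ->
  segment_density (n0%:R + a) (n1%:R + b) p =
  Beta_update a b n0 n1 * (`|p| ^+ n0 * `|1 - p| ^+ n1) * segment_density a b p.
Proof.
move=> a0 b0; rewrite /segment_density !patchE; case: ifPn => [|_]; last first.
  by rewrite mulr0.
rewrite inE/= in_itv/= => /andP[p0 p1].
rewrite /Beta_density !powR_natD ?subr_ge0// !ger0_norm ?subr_ge0//.
(* The Gamma and power values become atoms, with g = Gamma(a) Gamma(b) and gab = Gamma(a + b). *)
have update (K g gab x y z t : R) : g != 0 -> gab != 0 ->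
    K * (z * x * (t * y)) = K * (g / gab) * (z * t) * (gab / g * (x * y)).
  by move=> ? ?; field; apply/andP.
by apply: update; rewrite gt_eqF// ?mulr_gt0 ?Gamma_gt0// addr_gt0.
Qed.

Lemma measurable_power_weight n0 n1 (c : R) :
  measurable_fun [set: R * R] (fun q => c * (`|q.1| ^+ n0 * `|q.2| ^+ n1)).
Proof.
by apply: measurable_funM => //; apply: measurable_funM; apply: measurable_funX;
  apply: measurableT_comp.
Qed.

(** Conjugacy at the level of laws: pulled back to the parameter p, both sides have the same
    density. *)
Lemma Beta_density_update a b n0 n1 A : 0 < a -> 0 < b -> measurable A ->
  Beta (n0%:R + a) (n1%:R + b) A =
  density (Beta a b)
    (fun q => Beta_update a b n0 n1 * (`|q.1| ^+ n0 * `|q.2| ^+ n1)) A.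
Proof.
move=> a0 b0 mA; rewrite /density integral_mkcond.
have U0 : 0 <= Beta_update a b n0 n1.
  have an : 0 < n0%:R + a by rewrite ltr_wpDl.
  have bn : 0 < n1%:R + b by rewrite ltr_wpDl.
  have pos := (addr_gt0 an bn, addr_gt0 a0 b0).
  by apply: ltW; rewrite mulr_gt0 ?divr_gt0 ?mulr_gt0 ?Gamma_gt0 ?pos.
rewrite (ge0_integral_Beta a0 b0); last 2 first.
- apply/measurable_restrict => //; apply: measurable_funTS.
  by apply/measurable_EFinP; exact: measurable_power_weight.
- by move=> q; apply: erestrict_ge0 => {}q _; rewrite lee_fin mulr_ge0//.
rewrite BetaE /pushforward /density integral_mkcond; apply: eq_integral => p _.
rewrite !patchE; have -> : (p \in segment @^-1` A) = (segment p \in A) by [].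
case: ifPn => _; last by rewrite mul0e.
by rewrite segment_density_update.
Qed.

End Beta_law.

(** * Coordinates of grafted collections *)

Section branching_measurability.
Context {R : realType}.

Lemma measurable_branch_prob (k : nat) (y : seq bool) :
  measurable_fun [set: branching R k] (fun q => branch_prob q y).
Proof.
rewrite /branch_prob; case: insub => [i|]; last exact: measurable_cst.
move=> _ B mB; rewrite setTI; apply: sub_gen_smallest.
by exists i, B.
Qed.

(** Coordinates generate the target sigma-algebra, and each coordinate of a graft is a constant, a
    projection or a coordinate of a subtree. *)
Lemma measurable_graft (k k0 k1 : nat) :
  measurable_fun [set: (R * R) * (branching R k0 * branching R k1)] (graft k).
Proof.
apply: (@measurability _ _ _ (branching R k) _ _ (@coordinate_sets R k)) => //.
move=> _ [_ [y [B [mB ->]]] <-]; rewrite setTI.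
suff my : measurable_fun [set: (R * R) * (branching R k0 * branching R k1)]
    (fun t => graft k t y).
  by have := my measurableT _ mB; rewrite setTI.
rewrite /graft; case: (sval y) => [|b [|c y']].
- exact: measurable_cst.
- by case: b; apply: measurableT_comp.
- have m1 : measurable_fun [set: (R * R) * (branching R k0 * branching R k1)]
      (fun t => t.2.1) by exact: measurableT_comp.
  have m2 : measurable_fun [set: (R * R) * (branching R k0 * branching R k1)]
      (fun t => t.2.2) by exact: measurableT_comp.
  case: b.
    exact: (measurableT_comp (@measurable_branch_prob k1 (c :: y')) m2).
  exact: (measurableT_comp (@measurable_branch_prob k0 (c :: y')) m1).
Qed.

Lemma branch_prob_graft1 (k k0 k1 : nat) (b : bool)
    (t : (R * R) * (branching R k0 * branching R k1)) : (0 < k)%N ->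
  branch_prob (graft k t) [:: b] = if b then t.1.2 else t.1.1.
Proof. by move=> k_gt0; rewrite /branch_prob insubT. Qed.

Lemma branch_prob_graft (k k0 k1 : nat) (b : bool) (y : seq bool)
    (t : (R * R) * (branching R k0 * branching R k1)) :
  (0 < size y < k)%N ->
  branch_prob (graft k t) (b :: y) =
  if b then branch_prob t.2.2 y else branch_prob t.2.1 y.
Proof. by case: y => [//|c y] yk; rewrite {1}/branch_prob insubT. Qed.

Lemma branch_prob_uniform (k : nat) (y : seq bool) :
  (0 < size y <= k)%N -> branch_prob (uniform_branching k) y = 2^-1 :> R.
Proof. by move=> yk; rewrite /branch_prob insubT. Qed.

Lemma branch_prob_out (k : nat) (q : branching R k) (y : seq bool) :
  ~~ (0 < size y <= k)%N -> branch_prob q y = 0.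
Proof. by move=> yk; rewrite /branch_prob insubN. Qed.

End branching_measurability.

Section probability_of_measure.
Context d (T : measurableType d) (R : realType).
Variables (mu : {measure set T -> \bar R}) (mu1 : mu setT = 1%E).

Let P : set T -> \bar R := mu.
HB.instance Definition _ := Measure.on P.
HB.instance Definition _ := Measure_isProbability.Build _ _ _ P mu1.

Definition probability_of_measure : probability T R := P.

End probability_of_measure.

HB.instance Definition _ (R : realType) (k k0 k1 : nat) :=
  isMeasurableFun.Build _ _ _ _ (@graft R k k0 k1)
    (@measurable_graft R k k0 k1).

(** * The prior as a probability measure *)

Section prior_measure.
Context {R : realType} (alpha u s : R).
Hypotheses (alpha_gt0 : 0 < alpha) (u_ge0 : 0 <= u) (s_ge0 : 0 <= s).
Local Open Scope ereal_scope.

Definition branch_probability (k : nat) {k0 k1 : nat} (a b : R)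
    (a0 : (0 < a)%R) (b0 : (0 < b)%R) (P0 : probability (branching R k0) R)
    (P1 : probability (branching R k1) R) : probability (branching R k) R :=
  distribution (Beta_probability a0 b0 \x (P0 \x P1)) (@graft R k k0 k1).

Lemma prior_recS k k0 k1 (P0 : probability (branching R k0) R)
    (P1 : probability (branching R k1) R) : k = k0.+1 -> k1 = k0 ->
  prior_rec alpha u s k0 = P0 -> prior_rec alpha u s k1 = P1 ->
  prior_rec alpha u s k = measure_add
    (mscale (NngNum u_ge0) (dirac (uniform_branching k)))
    (mscale (NngNum s_ge0) (branch_probability k alpha_gt0 alpha_gt0 P0 P1)).
Proof.
move=> kE k1E; subst k k1 => P0E P1E; apply/funext => A; rewrite measure_addE.
transitivity (u%:E * delta_half k0.+1 A +
  s%:E * branch_law k0.+1 alpha alpha P0 P1 A); last by [].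
by rewrite -P0E -P1E.
Qed.

(** Rewriting with this equation temporarily replaces the bare [prior_rec] by a bundled measure, to
    which the integration lemmas apply. *)
Lemma prior_rec_probability k : (u + s = 1)%R ->
  exists P : probability (branching R k) R, prior_rec alpha u s k = P.
Proof.
move=> us1; elim: k => [|k [P PE]].
  by exists (dirac (uniform_branching 0)).
have mE := prior_recS erefl erefl PE PE.
set m := measure_add _ _ in mE.
have m1 : m setT = 1.
  rewrite /m measure_addE; transitivity (u%:E * 1 + s%:E * 1).
    by congr (_ * _ + _ * _); [exact: diracT|
      exact: (probability_setT
        (branch_probability k.+1 alpha_gt0 alpha_gt0 P P))].
  by rewrite -!EFinM -EFinD !mulr1 us1.
by exists (probability_of_measure m1).
Qed.

Lemma ge0_integral_prior_recS k k0 k1 (P0 : probability (branching R k0) R)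
    (P1 : probability (branching R k1) R) (f : branching R k -> \bar R) :
  k = k0.+1 -> k1 = k0 ->
  prior_rec alpha u s k0 = P0 -> prior_rec alpha u s k1 = P1 ->
  measurable_fun [set: branching R k] f -> (forall q, 0 <= f q) ->
  \int[prior_rec alpha u s k]_q f q = u%:E * f (uniform_branching k) +
    s%:E * \int[Beta_probability alpha_gt0 alpha_gt0 \x (P0 \x P1)]_t
      f (graft k t).
Proof.
move=> kE k1E P0E P1E mf f0; rewrite (prior_recS kE k1E P0E P1E).
rewrite ge0_integral_measure_add// !ge0_integral_mscale//.
rewrite integral_dirac// diracT mul1e; congr (_ + _ * _).
by rewrite ge0_integral_pushforward.
Qed.

Lemma measurable_lt0 d (T : measurableType d) (f : T -> R) :
  measurable_fun [set: T] f -> measurable [set x | (f x < 0)%R].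
Proof.
move=> mf; have := mf measurableT _ (measurable_itv `]-oo, 0%R[).
by rewrite setTI; congr measurable.
Qed.

Lemma Beta_segment_lt0 a b (c : R * R -> R) :
  (forall p, 0 <= p <= 1 -> 0 <= c (segment p))%R ->
  Beta a b [set q | (c q < 0)%R] = 0.
Proof.
move=> c0; rewrite /Beta [X in integral _ X](_ : _ = set0) ?integral_set0//.
apply/seteqP; split => // p /= []; rewrite in_itv/= => /c0.
by rewrite leNgt => /negP nc /nc.
Qed.

(** By induction on the height: the point mass has coordinates 1/2, the two top coordinates of a
    graft lie on the Beta segment, and deeper ones fall under the induction hypothesis. This makes
    likelihoods nonnegative almost surely. *)
Lemma prior_rec_branch_prob_lt0 k y : (u + s = 1)%R ->
  prior_rec alpha u s k [set q | (branch_prob q y < 0)%R] = 0.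
Proof.
move=> us1; elim: k y => [|k IH] y.
  rewrite /= /delta_half diracE memNset//=.
  by rewrite branch_prob_out ?ltxx// leqn0; case: y.
have [P PE] := prior_rec_probability k us1.
rewrite PE in IH.
rewrite (prior_recS erefl erefl PE PE) measure_addE /= /mscale /=.
rewrite [X in _ * X + _](_ : _ = 0); last first.
  rewrite diracE memNset//=; apply/negP; rewrite -leNgt.
  have [yk|yk] := boolP (0 < size y <= k.+1)%N.
    by rewrite branch_prob_uniform// invr_ge0.
  by rewrite branch_prob_out.
rewrite mule0 add0e [X in _ * X](_ : _ = 0) ?mule0//.
have mlt j z : measurable [set q : branching R j | (branch_prob q z < 0)%R].
  by apply: measurable_lt0; exact: measurable_branch_prob.
pose B := Beta_probability alpha_gt0 alpha_gt0.
pose A := @graft R k.+1 k k @^-1` [set q | (branch_prob q y < 0)%R].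
change ((B \x (P \x P)) A = 0).
(* Outside the index range [branch_prob] takes its default 0, so the event is empty. *)
have [yk|yk] := boolP (0 < size y <= k.+1)%N; last first.
  have -> : A = set0.
    by apply/seteqP; split => // t; rewrite /A /= branch_prob_out ?ltxx.
  pose BPP : probability _ R := B \x (P \x P).
  exact: (measure0 BPP).
case: y yk @A => [//|b [|c y]] yk A.
  have -> : A = [set q : R * R | (if b then q.2 else q.1) < 0]%R `*` setT.
    apply/seteqP; split => t; rewrite /A /= branch_prob_graft1//.
    by move=> [h _].
  pose PP : probability _ R := P \x P.
  rewrite [LHS](@product_measure1E _ _ _ _ _ B PP)//; last first.
    apply: measurable_lt0.
    by case: (b); [exact: measurable_snd|exact: measurable_fst].
  rewrite [X in X * _]Beta_segment_lt0 ?mul0e// => p /andP[p0 p1].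
  by case: (b) => //=; rewrite subr_ge0.
pose N := [set q : branching R k | (branch_prob q (c :: y) < 0)%R].
(* A deeper coordinate constrains one subtree only: the event is a rectangle with a null side. *)
have -> : A = setT `*` (if b then setT `*` N else N `*` setT).
  apply/seteqP; split => t; rewrite /A /= branch_prob_graft//.
    by case: (b) => ?; split => //; split.
  by case: (b) => -[_ []].
have mN : measurable N by exact: mlt.
have N0 : P N = 0 by exact: IH.
pose PP : probability _ R := P \x P.
rewrite [LHS](@product_measure1E _ _ _ _ _ B PP)//; last first.
  by case: (b); exact: measurableX.
suff : PP (if b then setT `*` N else N `*` setT) = 0.
  by move=> PP0; rewrite [X in _ * X]PP0 mule0.
case: (b); rewrite [LHS](@product_measure1E _ _ _ _ _ P P)//.
  by rewrite [X in _ * X]N0 mule0.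
by rewrite [X in X * _]N0 mul0e.
Qed.

End prior_measure.

(** * Conjugacy at one node *)

Section posterior_core.
Context {R : realType} (alpha u s : R).
Hypotheses (alpha_gt0 : 0 < alpha) (u_ge0 : 0 <= u) (s_ge0 : 0 <= s).
Hypothesis us1 : u + s = 1.
Local Open Scope ereal_scope.

(** Thus 1 / [weight] is the mean of (2 q0)^n0 (2 q1)^n1 under Beta(alpha, alpha). *)
Lemma weightE n0 n1 :
  weight alpha n0 n1 = (Beta_update alpha alpha n0 n1 / 2 ^+ (n0 + n1))%R.
Proof.
rewrite /weight /Beta_update -mulrA mulrC.
have -> : (2 * alpha = alpha + alpha)%R by ring.
by rewrite expr2 natrD addrACA.
Qed.

Lemma weight_gt0 n0 n1 : (0 < weight alpha n0 n1)%R.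
Proof.
have an n : (0 < n%:R + alpha)%R by rewrite ltr_wpDl.
rewrite weightE divr_gt0 ?exprn_gt0//.
have pos := (addr_gt0 (an n0) (an n1), addr_gt0 alpha_gt0 alpha_gt0).
by rewrite mulr_gt0 ?divr_gt0 ?mulr_gt0 ?Gamma_gt0 ?pos.
Qed.

Local Opaque Gamma weight Beta_update.

(** [L], [L0], [L1] stand for absolute likelihoods at a node and its children, [p0], [p1] for the
    evidences of the children and [m0], [m1] for their posteriors. All stay abstract so that the
    step can be used before evidences are known to be positive and finite. *)
Section step.
Variables (k k0 k1 : nat) (n0 n1 : nat) (p0 p1 : R).
Variables (L : branching R k -> R) (L0 : branching R k0 -> R)
  (L1 : branching R k1 -> R).
Hypotheses (kE : k = k0.+1) (k1E : k1 = k0).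
Hypotheses (mL : measurable_fun [set: branching R k] L)
  (L_ge0 : forall q, (0 <= L q)%R).
Hypotheses (mL0 : measurable_fun [set: branching R k0] L0)
  (L0_ge0 : forall q, (0 <= L0 q)%R).
Hypotheses (mL1 : measurable_fun [set: branching R k1] L1)
  (L1_ge0 : forall q, (0 <= L1 q)%R).
Hypothesis L_uniform : L (uniform_branching k) = 1%R.
Hypothesis L_graft : forall t : (R * R) * (branching R k0 * branching R k1),
  L (graft k t) = (2 ^+ (n0 + n1) * (`|t.1.1| ^+ n0 * `|t.1.2| ^+ n1) *
    (L0 t.2.1 * L1 t.2.2))%R.
Hypotheses (p0_gt0 : (0 < p0)%R) (p1_gt0 : (0 < p1)%R).
Hypothesis L0_total : \int[prior_rec alpha u s k0]_q (L0 q)%:E = p0%:E.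
Hypothesis L1_total : \int[prior_rec alpha u s k1]_q (L1 q)%:E = p1%:E.
Variables (m0 : set (branching R k0) -> \bar R)
  (m1 : set (branching R k1) -> \bar R).
Hypothesis m0E : forall A, measurable A ->
  m0 A = density (prior_rec alpha u s k0) (fun q => L0 q / p0)%R A.
Hypothesis m1E : forall A, measurable A ->
  m1 A = density (prior_rec alpha u s k1) (fun q => L1 q / p1)%R A.

Local Notation a0 := (n0%:R + alpha)%R.
Local Notation a1 := (n1%:R + alpha)%R.
Local Notation B := (Beta_probability alpha_gt0 alpha_gt0).

Let f (q : R * R) :=
  (Beta_update alpha alpha n0 n1 * (`|q.1| ^+ n0 * `|q.2| ^+ n1))%R.
Let h0 q := (L0 q / p0)%R.
Let h1 q := (L1 q / p1)%R.

Let Beta_update_gt0 : (0 < Beta_update alpha alpha n0 n1)%R.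
Proof.
have := weight_gt0 n0 n1; rewrite weightE.
by rewrite pmulr_lgt0 ?invr_gt0 ?exprn_gt0.
Qed.

Let f_ge0 q : (0 <= f q)%R.
Proof. by rewrite mulr_ge0 ?(ltW Beta_update_gt0)// mulr_ge0 ?exprn_ge0. Qed.

Let mf : measurable_fun [set: R * R] f.
Proof. exact: measurable_power_weight. Qed.

Let h0_ge0 q : (0 <= h0 q)%R. Proof. by rewrite divr_ge0// ltW. Qed.

Let h1_ge0 q : (0 <= h1 q)%R. Proof. by rewrite divr_ge0// ltW. Qed.

Let mh0 : measurable_fun [set: branching R k0] h0.
Proof. exact: measurable_funM. Qed.

Let mh1 : measurable_fun [set: branching R k1] h1.
Proof. exact: measurable_funM. Qed.

Let h01_ge0 (z : branching R k0 * branching R k1) : (0 <= h0 z.1 * h1 z.2)%R.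
Proof. exact: mulr_ge0. Qed.

Let mh01 : measurable_fun [set: branching R k0 * branching R k1]
  (fun z => h0 z.1 * h1 z.2)%R.
Proof.
apply: measurable_funM; first exact: measurableT_comp mh0 measurable_fst.
exact: measurableT_comp mh1 measurable_snd.
Qed.

(** [product_density] is used twice, inside out: on the pair of subtrees, then against the Beta
    factor. *)
Let branch_law_density (P0 : probability (branching R k0) R)
    (P1 : probability (branching R k1) R) A :
  prior_rec alpha u s k0 = P0 -> prior_rec alpha u s k1 = P1 ->
  measurable A ->
  branch_law k a0 a1 m0 m1 A =
  density (B \x (P0 \x P1)) (fun t => f t.1 * (h0 t.2.1 * h1 t.2.2))%R
    (@graft R k k0 k1 @^-1` A).
Proof.
move=> P0E P1E mA.
have m0P C : measurable C -> m0 C = density P0 h0 C by rewrite -P0E; exact: m0E.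
have m1P C : measurable C -> m1 C = density P1 h1 C by rewrite -P1E; exact: m1E.
have mE C : measurable C -> (m0 \x m1) C =
    density (P0 \x P1) (fun z => h0 z.1 * h1 z.2)%R C.
  by move=> mC; exact: product_density.
pose PP : probability _ R := P0 \x P1.
apply: (@product_density _ _ _ _ _ B PP f (fun z => h0 z.1 * h1 z.2)%R) => //.
  by move=> C mC; exact: Beta_density_update.
by rewrite -[X in measurable X]setTI; exact: measurable_graft.
Qed.

Lemma integral_prior_step A : measurable A ->
  \int[prior_rec alpha u s k]_(q in A) (L q)%:E =
  u%:E * delta_half k A +
  (s * (p0 * p1 / weight alpha n0 n1))%:E * branch_law k a0 a1 m0 m1 A.
Proof.
move=> mA.
have [Pk PkE] := prior_rec_probability alpha_gt0 u_ge0 s_ge0 k us1.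
(* [integral_mkcond] needs a bundled measure; the recursive form is restored at once. *)
rewrite PkE integral_mkcond -PkE.
have [P0 P0E] := prior_rec_probability alpha_gt0 u_ge0 s_ge0 k0 us1.
have [P1 P1E] := prior_rec_probability alpha_gt0 u_ge0 s_ge0 k1 us1.
have mLA : measurable_fun [set: branching R k] ((EFin \o L) \_ A).
  apply/measurable_restrict => //; apply: measurable_funTS.
  exact/measurable_EFinP.
rewrite (ge0_integral_prior_recS alpha_gt0 u_ge0 s_ge0 kE k1E P0E P1E)//;
  last first.
  by move=> q; apply: erestrict_ge0 => {}q _; rewrite lee_fin.
congr (_ * _ + _).
  by rewrite patchE /delta_half diracE; case: ifPn; rewrite /= ?L_uniform.
rewrite (branch_law_density P0E P1E mA) EFinM -muleA; congr (_ * _).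
rewrite /density.
pose PP : probability _ R := P0 \x P1.
rewrite [in RHS](@integral_mkcond _ _ _ (B \x PP)).
have w0 := weight_gt0 n0 n1.
have mgA : measurable (@graft R k k0 k1 @^-1` A).
  by rewrite -[X in measurable X]setTI; exact: measurable_graft.
pose F := (fun t : (R * R) * (branching R k0 * branching R k1) =>
  (f t.1 * (h0 t.2.1 * h1 t.2.2))%:E) \_ (@graft R k k0 k1 @^-1` A).
have mF : measurable_fun [set: (R * R) * (branching R k0 * branching R k1)] F.
  apply/measurable_restrict => //; apply: measurable_funTS.
  apply/measurable_EFinP.
  apply: measurable_funM; first exact: measurableT_comp mf measurable_fst.
  exact: measurableT_comp mh01 measurable_snd.
have F0 t : 0 <= F t.
  by apply: erestrict_ge0 => {}t _; rewrite lee_fin; exact: mulr_ge0.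
have c0 : 0 <= (p0 * p1 / weight alpha n0 n1)%:E.
  by rewrite lee_fin; apply: ltW; rewrite divr_gt0// mulr_gt0.
rewrite -[RHS](@ge0_integralZl _ _ _ (B \x PP) _ measurableT F mF _
  (fun t _ => F0 t) c0).
(* The constant p0 p1 / w removes the normalizations of [f], [h0] and [h1], and leaves the factor
   2^(n0+n1) of the likelihood. *)
have E t : ((EFin \o L) \_ A) (graft k t) =
    (p0 * p1 / weight alpha n0 n1)%:E * F t.
  rewrite /F patchE [in RHS]patchE.
  have -> : (t \in @graft R k k0 k1 @^-1` A) = (graft k t \in A) by [].
  case: ifPn => _; last by rewrite mule0.
  rewrite -EFinM /= L_graft /f /h0 /h1 weightE; congr EFin.
  have update (U e X l0 l1 q0 q1 : R) : U != 0%R -> e != 0%R ->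
      q0 != 0%R -> q1 != 0%R ->
      (e * X * (l0 * l1) =
       q0 * q1 / (U / e) * (U * X * (l0 / q0 * (l1 / q1))))%R.
    by move=> ? ? ? ?; field; apply/and4P.
  by apply: update; rewrite gt_eqF// exprn_gt0.
congr (integral _ _ _).
by apply/funext => t; exact: E.
Qed.

Lemma branch_law_setT : branch_law k a0 a1 m0 m1 setT = 1.
Proof.
have [P0 P0E] := prior_rec_probability alpha_gt0 u_ge0 s_ge0 k0 us1.
have [P1 P1E] := prior_rec_probability alpha_gt0 u_ge0 s_ge0 k1 us1.
rewrite (branch_law_density P0E P1E)// preimage_setT /density.
pose PP : probability _ R := P0 \x P1.
rewrite [LHS](@integral_product_density _ _ _ _ _ B PP f
  (fun z => h0 z.1 * h1 z.2)%R)//.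
(* By conjugacy this integral is the total mass of the updated Beta law. *)
rewrite (_ : \int[B]_x (f x)%:E = 1); last first.
  have a0_gt0 : (0 < a0)%R by rewrite ltr_wpDl.
  have a1_gt0 : (0 < a1)%R by rewrite ltr_wpDl.
  rewrite -[RHS](probability_setT (Beta_probability a0_gt0 a1_gt0)).
  by apply/esym; exact: Beta_density_update.
rewrite mul1e [LHS](@integral_product_density _ _ _ _ _ P0 P1 h0 h1)//.
have normalized j (P : probability (branching R j) R)
    (h : branching R j -> R) (p : R) :
    prior_rec alpha u s j = P -> measurable_fun [set: branching R j] h ->
    (forall q, (0 <= h q)%R) -> (0 < p)%R ->
    \int[prior_rec alpha u s j]_q (h q)%:E = p%:E -> \int[P]_q (h q / p)%:E = 1.
  move=> PE mh h_ge0 p_gt0 hp; under eq_integral do rewrite EFinM.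
  rewrite ge0_integralZr//; last 3 first.
  - exact/measurable_EFinP.
  - by move=> q _; rewrite lee_fin.
  - by rewrite lee_fin invr_ge0 ltW.
  by rewrite -PE hp -EFinM mulfV// gt_eqF.
by rewrite !normalized// mule1.
Qed.


End step.
End posterior_core.

(** * Likelihoods on the tree *)

Section tree_address.
Context {d} {G : measurableType d} {R : realType} {vol : probability G R}.
Context {m : nat} {cell : seq bool -> set G}.
Hypothesis hcell : tree_partition vol m cell.

Lemma cell_extend (w : seq bool) (x : G) (j : nat) :
  cell w x -> (size w + j <= m)%N -> exists2 y, size y = j & cell (w ++ y) x.
Proof.
move=> wx; elim: j => [|j IH] jm; first by exists [::]; rewrite ?cats0.
have [|y yj] := IH; first by rewrite (leq_trans _ jm)// leq_add2l.
have := cell_split _ _ _ hcell (w ++ y).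
rewrite size_cat yj -addnS => /(_ jm) -> [] cx.
  by exists (rcons y false); rewrite ?size_rcons ?yj// -rcons_cat.
by exists (rcons y true); rewrite ?size_rcons ?yj// -rcons_cat.
Qed.

Lemma cell_rcons (z : seq bool) (b : bool) (x : G) : (size z < m)%N ->
  cell (rcons z b) x -> cell z x.
Proof.
move=> zm cx; rewrite (cell_split _ _ _ hcell z zm).
by case: b cx; [right|left].
Qed.

Lemma cell_rcons_inj (z : seq bool) (b c : bool) (x : G) : (size z < m)%N ->
  cell (rcons z b) x -> cell (rcons z c) x -> b = c.
Proof.
move=> zm; have D := cell_disjoint _ _ _ hcell z zm.
by case: b; case: c => // bx cx; suff : set0 x by []; rewrite -D; split.
Qed.

(** Strings are peeled from the end, where the partition axioms extend them. *)
Lemma cell_inj (y y' : seq bool) (x : G) :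
  (size y <= m)%N -> size y = size y' ->
  cell y x -> cell y' x -> y = y'.
Proof.
elim/last_ind: y y' => [|y b IH] y'; first by case: y'.
case/lastP: y' => [|y' b']; rewrite !size_rcons// => ym [yy'] yx y'x.
have ?: y = y'.
  by apply: IH (cell_rcons _ yx) (cell_rcons _ y'x); rewrite ?(ltnW ym)// -yy'.
by subst y'; rewrite (cell_rcons_inj _ yx y'x).
Qed.

Lemma address_size (y : seq bool) (x : G) : (size y <= m)%N -> cell y x ->
  address cell x (size y) = y.
Proof.
move=> ym yx; apply: xget_unique => // y' [y'y y'x].
by apply: cell_inj y'x yx; rewrite ?y'y.
Qed.

(** [w] can be extended to length i within cells containing x, and by uniqueness that extension is
    the address. *)
Lemma address_cat (w : seq bool) (x : G) (i : nat) : cell w x ->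
  (size w <= i <= m)%N ->
  exists2 y, size y = (i - size w)%N & address cell x i = w ++ y.
Proof.
move=> wx /andP[wi im].
have [|y yj yx] := @cell_extend w x (i - size w) wx; first by rewrite subnKC.
exists y => //; rewrite -[RHS](@address_size _ x)// size_cat yj subnKC//.
Qed.

End tree_address.

(** * Factorization of the likelihood along a graft *)

Section likelihood.
Context {d} {G : measurableType d} {R : realType} {vol : probability G R}.
Context {m : nat} {cell : seq bool -> set G}.
Hypothesis hcell : tree_partition vol m cell.

Local Notation lik z := (@likelihood _ G R m cell z).
Local Notation plik z := (@point_likelihood _ G R m cell z).

Lemma measurable_likelihood z (E : seq G) :
  measurable_fun [set: branching R (m - size z)] (lik z E).
Proof.
apply: measurable_prod => x _; apply: measurable_prod => i _.
by apply: measurable_funM => //; exact: measurable_branch_prob.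
Qed.

Lemma likelihood_uniform z (E : seq G) :
  lik z E (uniform_branching (m - size z)) = 1.
Proof.
rewrite /likelihood big1_seq// => x _; rewrite /point_likelihood big_nat.
rewrite big1// => i /andP[zi im].
(* Starting from the root, whose cell contains every x, the address has length i even when x lies
   outside the cell of z. *)
have [||y yi ->] := @address_cat _ _ _ _ _ _ hcell [::] x i.
- by rewrite (cell_root _ _ _ hcell).
- by rewrite /=; lia.
by rewrite branch_prob_uniform ?mulfV//= size_drop; move: yi => /=; lia.
Qed.

(** The factor of length |z| + 1 is the branching at z; every longer address starts with z followed
    by b, so its factor reads a coordinate of subtree b. *)
Lemma point_likelihood_graft z b x
    (t : (R * R) * (branching R (m - size (rcons z false)) *
                    branching R (m - size (rcons z true)))) :
  (size z < m)%N -> cell (rcons z b) x ->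
  plik z x (graft (m - size z) t) =
  2 * (if b then t.1.2 else t.1.1) *
  (if b then plik (rcons z true) x t.2.2 else plik (rcons z false) x t.2.1).
Proof.
move=> zm bx.
have dropr c y : drop (size z).+1 (rcons z c ++ y) = y.
  by rewrite -(size_rcons z c) drop_size_cat.
rewrite /point_likelihood big_ltn//; congr (_ * _).
  have := @address_size _ _ _ _ _ _ hcell (rcons z b) x.
  rewrite size_rcons => -> //.
  have -> : drop (size z) (rcons z b) = [:: b] by rewrite -cats1 drop_size_cat.
  by rewrite branch_prob_graft1 ?subn_gt0.
(* This middle form drops |z| + 1 letters for both children, whose sizes equal that number only
   after rewriting. *)
transitivity (\prod_((size z).+2 <= i < m.+1)
   (2 * (let y := drop (size z).+1 (address cell x i) in
         if b then branch_prob t.2.2 y else branch_prob t.2.1 y))).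
  rewrite big_nat [RHS]big_nat; apply: eq_bigr => i /andP[zi im].
  have [|y yi ->] := @address_cat _ _ _ _ _ _ hcell (rcons z b) x i bx.
    by rewrite size_rcons; lia.
  have -> : drop (size z) (rcons z b ++ y) = b :: y.
    by rewrite cat_rcons drop_size_cat.
  by rewrite dropr branch_prob_graft// yi size_rcons; lia.
by case: b bx => bx; apply: congr_big_nat; rewrite ?size_rcons// => i _;
  congr (_ * branch_prob _ (drop _ _)); rewrite size_rcons.
Qed.

Lemma likelihood_graft z (D : seq G)
    (t : (R * R) * (branching R (m - size (rcons z false)) *
                    branching R (m - size (rcons z true)))) :
  (size z < m)%N ->
  let n0 := size (subdata cell D (rcons z false)) in
  let n1 := size (subdata cell D (rcons z true)) in
  lik z (subdata cell D z) (graft (m - size z) t) =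
  2 ^+ (n0 + n1) * (t.1.1 ^+ n0 * t.1.2 ^+ n1) *
  (lik (rcons z false) (subdata cell D (rcons z false)) t.2.1 *
   lik (rcons z true) (subdata cell D (rcons z true)) t.2.2).
Proof.
move=> zm /=; rewrite /likelihood; elim: D => [|x D IH].
  by rewrite /= !big_nil !expr0 !mulr1.
rewrite /=; have [zx|zx] := boolP (x \in cell z); last first.
  have nx b : (x \in cell (rcons z b)) = false.
    by apply: contraNF zx; rewrite !inE; exact: (cell_rcons hcell).
  by rewrite !nx.
rewrite big_cons.
move: zx; rewrite inE (cell_split _ _ _ hcell z zm) => -[] cx.
- have -> : (x \in cell (rcons z false)) = true by exact: mem_set.
  have -> : (x \in cell (rcons z true)) = false.
    by apply: memNset => cx'; have := cell_rcons_inj hcell zm cx cx'.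
  rewrite big_cons /= (point_likelihood_graft t zm cx) IH /=.
  by rewrite addSn !exprS; ring.
- have -> : (x \in cell (rcons z true)) = true by exact: mem_set.
  have -> : (x \in cell (rcons z false)) = false.
    by apply: memNset => cx'; have := cell_rcons_inj hcell zm cx cx'.
  rewrite big_cons /= (point_likelihood_graft t zm cx) IH /=.
  by rewrite addnS !exprS; ring.
Qed.

End likelihood.

Lemma ae_prod_ge0 d (T : measurableType d) (R : realType)
    (P : {measure set T -> \bar R})
    (I : Type) (r : seq I) (f : I -> T -> R) :
  (forall i, {ae P, forall q, 0 <= f i q}) ->
  {ae P, forall q, 0 <= \prod_(i <- r) f i q}.
Proof.
move=> f0; elim: r => [|i r IH].
  by apply: aeW => q; rewrite big_nil.
by apply: filterS2 (f0 i) IH => q ? ?; rewrite big_cons mulr_ge0.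
Qed.

(** * Evidences and posteriors along the tree *)

Section posterior_recursion.
Context {d} {G : measurableType d} {R : realType} {vol : probability G R}.
Context {m : nat} {cell : seq bool -> set G}.
Hypothesis hcell : tree_partition vol m cell.
Variables alpha u s : R.
Hypotheses (alpha_gt0 : 0 < alpha) (u_ge0 : 0 <= u) (s_ge0 : 0 <= s).
Hypothesis us1 : u + s = 1.
Variable D : seq G.

Local Notation lik z := (@likelihood _ G R m cell z (subdata cell D z)).
Local Notation prior_at z := (prior_rec alpha u s (m - size z)).
Local Notation ev z := (evidence m cell alpha u s z (subdata cell D z)).
Local Notation post z := (posterior m cell alpha u s z (subdata cell D z)).
Local Notation absl z := (fun q => `|lik z q|).

Let mlik z : measurable_fun [set: branching R (m - size z)] (lik z).
Proof. exact: measurable_likelihood. Qed.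

Let mabs z : measurable_fun [set: branching R (m - size z)] (absl z).
Proof. exact: measurableT_comp. Qed.

Lemma likelihood_ge0_ae z (P : probability (branching R (m - size z)) R) :
  prior_at z = P -> {ae P, forall q, 0 <= lik z q}.
Proof.
move=> PE; apply: ae_prod_ge0 => x; apply: ae_prod_ge0 => i.
exists [set q | branch_prob q (drop (size z) (address cell x i)) < 0]; split.
- by apply: measurable_lt0; exact: measurable_branch_prob.
- by rewrite -PE prior_rec_branch_prob_lt0.
- by move=> q /= /negP; rewrite -ltNge pmulr_rlt0.
Qed.

(* Branching probabilities range over all reals, so the likelihood is only
   almost surely nonnegative; its absolute value gives nonnegative
   integrands. *)
Lemma integral_likelihood_abs z (c : R) A : measurable A ->
  (\int[prior_at z]_(q in A) (lik z q * c)%:E =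
   \int[prior_at z]_(q in A) (`|lik z q| * c)%:E)%E.
Proof.
move=> mA.
have [P PE] :=
  prior_rec_probability alpha_gt0 u_ge0 s_ge0 (m - size z) us1.
rewrite PE; apply: ae_eq_integral => //.
- apply: measurable_funTS; apply/measurable_EFinP.
  by apply: measurable_funM => //; exact: mlik.
- apply: measurable_funTS; apply/measurable_EFinP.
  by apply: measurable_funM => //; exact: mabs.
apply: filterS (likelihood_ge0_ae PE) => q q0 _.
by rewrite ger0_norm.
Qed.

Lemma posteriorE z A : measurable A ->
  post z A = density (prior_at z) (fun q => `|lik z q| / ev z) A.
Proof. exact: integral_likelihood_abs. Qed.

Lemma evidenceE z :
  ev z = fine (\int[prior_at z]_q (`|lik z q|)%:E).
Proof.
rewrite /evidence /prior; congr fine.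
have := @integral_likelihood_abs z 1 setT measurableT.
have mul1 (h : branching R (m - size z) -> R) :
    (fun q => (h q * 1)%:E) = (fun q => (h q)%:E).
  by apply/funext => q; rewrite mulr1.
by rewrite (mul1 (lik z)) (mul1 (absl z)).
Qed.

Let leaf_size (z : seq bool) : size z = m -> (m - size z)%N = 0%N.
Proof. by move=> ->; rewrite subnn. Qed.

Lemma prior_leaf (z : seq bool) :
  size z = m -> prior_at z = delta_half (m - size z).
(* The height occurs in types, so it is generalized before becoming 0. *)
Proof. by move=> /leaf_size; move: (m - size z)%N => k ->. Qed.

Let likU z : `|lik z (uniform_branching (m - size z))| = 1.
Proof. by rewrite (likelihood_uniform hcell) normr1. Qed.

Lemma integral_leaf (z : seq bool) (c : R) A : size z = m -> measurable A ->
  (\int[prior_at z]_(q in A) (`|lik z q| * c)%:E =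
   c%:E * delta_half (m - size z) A)%E.
Proof.
move=> zm mA; rewrite prior_leaf// /delta_half integral_dirac//.
  by rewrite likU mul1r muleC.
apply: measurable_funTS; apply/measurable_EFinP.
by apply: measurable_funM => //; exact: mabs.
Qed.

Let likG z t : (size z < m)%N -> `|lik z (graft (m - size z) t)| =
  let n0 := size (subdata cell D (rcons z false)) in
  let n1 := size (subdata cell D (rcons z true)) in
  2 ^+ (n0 + n1) * (`|t.1.1| ^+ n0 * `|t.1.2| ^+ n1) *
  (`|lik (rcons z false) t.2.1| * `|lik (rcons z true) t.2.2|).
Proof.
move=> zm; rewrite (likelihood_graft hcell)//= !normrM !normrX.
by rewrite (@ger0_norm _ 2).
Qed.

Let heightS (z : seq bool) b : (size z < m)%N ->
  (m - size z)%N = (m - size (rcons z b)).+1.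
Proof. by move=> zm; rewrite size_rcons; lia. Qed.

Let height_eq (z : seq bool) :
  (m - size (rcons z true))%N = (m - size (rcons z false))%N.
Proof. by rewrite !size_rcons. Qed.

Section node.
Variable z : seq bool.
Hypothesis zm : (size z < m)%N.

Local Notation z0 := (rcons z false).
Local Notation z1 := (rcons z true).
Local Notation n0 := (size (subdata cell D z0)).
Local Notation n1 := (size (subdata cell D z1)).

Lemma integral_likelihood_step p0 p1 m0 m1 A : 0 < p0 -> 0 < p1 ->
  (forall B, measurable B ->
    m0 B = density (prior_at z0) (fun q => absl z0 q / p0) B) ->
  (forall B, measurable B ->
    m1 B = density (prior_at z1) (fun q => absl z1 q / p1) B) ->
  measurable A ->
  (\int[prior_at z]_(q in A) (`|lik z q|)%:E =
   u%:E * delta_half (m - size z) A +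
   (s * (p0 * p1 / weight alpha n0 n1))%:E *
   branch_law (m - size z) (n0%:R + alpha) (n1%:R + alpha) m0 m1 A)%E.
Proof.
move=> p0_gt0 p1_gt0 m0E m1E mA.
exact: (@integral_prior_step R alpha u s alpha_gt0 u_ge0 s_ge0 us1
  _ _ _ n0 n1 p0 p1 (absl z) (absl z0) (absl z1)
  (heightS false zm) (height_eq z) (@mabs z) (fun q => normr_ge0 _)
  (@mabs z0) (fun q => normr_ge0 _) (@mabs z1) (fun q => normr_ge0 _)
  (likU z) (fun t => likG t zm) p0_gt0 p1_gt0 m0 m1 m0E m1E A mA).
Qed.

Lemma total_likelihood_step p0 p1 : 0 < p0 -> 0 < p1 ->
  (\int[prior_at z0]_q (`|lik z0 q|)%:E = p0%:E)%E ->
  (\int[prior_at z1]_q (`|lik z1 q|)%:E = p1%:E)%E ->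
  (\int[prior_at z]_q (`|lik z q|)%:E =
   (u + s * (p0 * p1 / weight alpha n0 n1))%:E)%E.
Proof.
move=> p0_gt0 p1_gt0 p0E p1E.
(* The laws of the children are taken to be the normalized densities themselves, since [p0] and [p1]
   are not yet identified with evidences. *)
rewrite (integral_likelihood_step p0_gt0 p1_gt0
  (fun _ _ => erefl) (fun _ _ => erefl) measurableT).
have -> := branch_law_setT alpha_gt0 u_ge0 s_ge0 us1 (m - size z) n0 n1
  (@mabs z0) (fun q => normr_ge0 _) (@mabs z1) (fun q => normr_ge0 _)
  p0_gt0 p1_gt0 p0E p1E (fun _ _ => erefl) (fun _ _ => erefl).
by rewrite /delta_half diracT !mule1.
Qed.

End node.

(** Finiteness makes [fine] harmless, and positivity allows the division in [posterior]; both pass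
    from the children to the node by the evidence recursion. *)
Lemma evidence_gt0_abs z : (size z <= m)%N ->
  0 < ev z /\ (\int[prior_at z]_q (`|lik z q|)%:E = (ev z)%:E)%E.
Proof.
move=> zm; suff [p p0 pE] : exists2 p, 0 < p &
    (\int[prior_at z]_q (`|lik z q|)%:E = p%:E)%E.
  by rewrite evidenceE pE.
have [j] := ubnP (m - size z)%N.
elim: j => // j IH in z zm *; rewrite ltnS => jm.
have [zlt|] := ltnP (size z) m; last first.
  move=> mz; have {}zm : size z = m by apply/eqP; rewrite eqn_leq zm.
  exists 1 => //; have := integral_leaf 1 zm (@measurableT _ _).
  rewrite mul1e /delta_half diracT => <-; congr (integral _ _ _).
  by apply/funext => q; rewrite mulr1.
have IHb b : exists2 p, 0 < p &
    (\int[prior_at (rcons z b)]_q (`|lik (rcons z b) q|)%:E = p%:E)%E.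
  by apply: IH; rewrite size_rcons//; lia.
have [p0 p0_gt0 p0E] := IHb false.
have [p1 p1_gt0 p1E] := IHb true.
pose n0 := size (subdata cell D (rcons z false)).
pose n1 := size (subdata cell D (rcons z true)).
exists (u + s * (p0 * p1 / weight alpha n0 n1)).
  have w_gt0 := weight_gt0 alpha_gt0 n0 n1.
  have c_gt0 : 0 < p0 * p1 / weight alpha n0 n1 by rewrite divr_gt0// mulr_gt0.
  move: c_gt0; set c := (_ / _) => c_gt0.
  (* Either s = 0 and the sum is u = 1, or the branching term is positive even if u = 0. *)
  have [s0|s_gt0] := eqVneq s 0.
    by move: us1; rewrite s0 mul0r !addr0 => ->.
  by rewrite ltr_wpDl// mulr_gt0// lt_neqAle eq_sym s_gt0.
exact: total_likelihood_step.
Qed.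

Lemma posterior_step z : (size z < m)%N ->
  let z0 := rcons z false in
  let z1 := rcons z true in
  let n0 := size (subdata cell D z0) in
  let n1 := size (subdata cell D z1) in
  let g := s * (ev z0 * ev z1 / (ev z * weight alpha n0 n1)) in
  (forall A : set (branching R (m - size z)), measurable A ->
    post z A =
      ((u / ev z)%:E * delta_half (m - size z) A +
       g%:E * branch_law (m - size z) (n0%:R + alpha) (n1%:R + alpha)
                (post z0) (post z1) A)%E)
  /\ g = 1 - u / ev z.
Proof.
move=> zm z0 z1 n0 n1 g.
have [p_gt0 pE] := evidence_gt0_abs (ltnW zm).
have [|p0_gt0 p0E] := @evidence_gt0_abs z0; first by rewrite size_rcons.
have [|p1_gt0 p1E] := @evidence_gt0_abs z1; first by rewrite size_rcons.
have w_gt0 := weight_gt0 alpha_gt0 n0 n1.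
have := total_likelihood_step zm p0_gt0 p1_gt0 p0E p1E.
rewrite pE -/n0 -/n1 => -[pS].
have p_neq0 : ev z != 0 by rewrite gt_eqF.
have gE : g = (ev z)^-1 * (s * (ev z0 * ev z1 / weight alpha n0 n1)).
  by rewrite /g invfM; ring.
split; last first.
  (* The evidence recursion [pS] identifies the branching term with p_z(D_z) - u. *)
  by rewrite gE mulrC -[X in X / _](addKr u) -pS mulrDl mulNr mulfV// addrC.
move=> A mA; rewrite (posteriorE mA).
have [P PE] := prior_rec_probability alpha_gt0 u_ge0 s_ge0 (m - size z) us1.
have -> : density (prior_at z) (fun q => absl z q / ev z) A =
    ((ev z)^-1%:E * \int[prior_at z]_(q in A) (`|lik z q|)%:E)%E.
  rewrite /density PE muleC; under eq_integral do rewrite EFinM.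
  rewrite ge0_integralZr//.
  - by apply: measurable_funTS; apply/measurable_EFinP; exact: mabs.
  - by rewrite lee_fin invr_ge0 ltW.
rewrite (@integral_likelihood_step z zm _ _ (post z0) (post z1) A p0_gt0 p1_gt0
  (fun B mB => posteriorE mB) (fun B mB => posteriorE mB) mA).
rewrite -/n0 -/n1 gE; move: (branch_law _ _ _ _ _ A) => B.
rewrite [LHS]muleDr//.
by rewrite !muleA -!EFinM [in RHS](mulrC u).
Qed.

(** The same leaf integral over the whole space shows that the evidence is 1. *)
Lemma posterior_leaf z A : size z = m -> measurable A ->
  post z A = delta_half (m - size z) A.
Proof.
move=> zm mA; have [p_gt0 pE] := evidence_gt0_abs (eq_leq zm).
have := integral_leaf 1 zm (@measurableT _ _).
have mul1 : (fun q => (`|lik z q| * 1)%:E) = (fun q => (`|lik z q|)%:E).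
  by apply/funext => q; rewrite mulr1.
rewrite mul1 pE mul1e /delta_half diracT => -[p1].
by rewrite (posteriorE mA) [LHS]integral_leaf// p1 invr1 mul1e.
Qed.

End posterior_recursion.

Theorem theorem2 (R : realType) (d : measure_display) (G : measurableType d)
    (vol : probability G R) (m : nat) (cell : seq bool -> set G)
    (hcell : tree_partition vol m cell)
    (alpha u s : R) (halpha : 0 < alpha)
    (hu : 0 <= u <= 1) (hs : 0 <= s <= 1) (hus : u + s = 1)
    (D : seq G) (z : seq bool) (hz : (size z <= m)%N) :
  let z0 := rcons z false in
  let z1 := rcons z true in
  let n0 := size (subdata cell D z0) in
  let n1 := size (subdata cell D z1) in
  let p := fun y => evidence m cell alpha u s y (subdata cell D y) in
  let post := fun y => posterior m cell alpha u s y (subdata cell D y) in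
  let g := s * (p z0 * p z1 / (p z * weight alpha n0 n1)) in
  ((size z < m)%N ->
     (forall A : set (branching R (m - size z)), measurable A ->
        post z A =
          ((u / p z)%:E * delta_half (m - size z) A +
           g%:E * branch_law (m - size z) (n0%:R + alpha) (n1%:R + alpha)
                    (post z0) (post z1) A)%E)
     /\ g = 1 - u / p z)
  /\
  (size z = m ->
     forall A : set (branching R (m - size z)), measurable A ->
       post z A = delta_half (m - size z) A).
Proof.
move: hu hs => /andP[u_ge0 _] /andP[s_ge0 _] z0 z1 n0 n1 p post g; split.
  exact: (posterior_step hcell halpha u_ge0 s_ge0 hus).
by move=> zm A; exact: (posterior_leaf hcell halpha u_ge0 s_ge0 hus).
Qed.
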